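(* For every integer base $b\geq 2$, every fixed integer $j$ with $0<j<b$, and every real $x\geq 1$, $$\sum_{0\leq k\leq \log_b x}\left\lceil\frac{x+jb^k}{b^{k+1}}\right\rceil=\frac{n-s_b(n)}{b-1}+m+\lambda'_{b-j}+\left[c_{\nu_b(n)}\neq b-j\right],$$ where the sum is over integers $k$, $n=\lceil x\rceil$, $m=\lfloor\log_b n\rfloor$ is the position of the leading digit in the $b$-ary expansion of $n$, $s_b(n)$ is the sum of the $b$-ary digits $c_s$ of $n$, $\lambda'_i$ is the number of $b$-ary digits of $n$ that are greater than or equal to $i$, and $\nu_b(n)=\max\{k: b^k\mid n\}$.
   Context: The $b$-ary expansion of the positive integer $n=\lceil x\rceil$ is $n=\sum_{s=0}^{m}c_sb^s$ with $c_s\in\{0,1,\dots,b-1\}$, $m=\lfloor\log_b n\rfloor$ and $c_m\neq 0$. Then $s_b(n)=\sum_{s=0}^{m}c_s$ and $\lambda'_i=\#\{s:0\leq s\leq m,\ c_s\geq i\}$; that is, $\lambda'=(\lambda'_1\geq\cdots\geq\lambda'_{b-1})$ is the transpose of the partition $\lambda$ obtained by writing the $b$-ary digits of $n$ in descending order. The bracket $[P]$ is the Iverson bracket: $1$ if $P$ is true and $0$ if $P$ is false. Thus $c_{\nu_b(n)}$ is the lowest-order nonzero $b$-ary digit of $n$.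
   Formalization: The printed identity fails when x < b^m, i.e. b^(m-1) < x < b^m = n (e.g. b=2, j=1, x=3/2: 2 versus 3); the formal theorem proves it holds if and only if b^m ≤ x, and holds for every real x ≥ 1 when the sum runs over 0 ≤ k ≤ log_b n instead. *)

(* Defs.v *)
From HB Require Import structures.
From mathcomp Require Import all_boot all_order all_algebra.
From mathcomp Require Import all_classical all_reals all_analysis.

Set Implicit Arguments.
Unset Strict Implicit.
Unset Printing Implicit Defensive.
Import Order.TTheory GRing.Theory Num.Theory.

Local Open Scope ring_scope.

Definition logb (R : realType) (b : nat) (x : R) : R := ln x / ln b%:R.

(* For 1 < b and 0 < n, trunc_log b n is the floor of log_b n, the position of
   the leading digit. *)
Definition base_expansion (b n : nat) (c : nat -> nat) : Prop :=
  let m := trunc_log b n in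
  [/\ forall s, (s <= m)%N -> (c s < b)%N,
      c m <> 0%N &
      n = (\sum_(s < m.+1) c s * b ^ s)%N].

Definition digit_sum (b n : nat) (c : nat -> nat) : nat :=
  (\sum_(s < (trunc_log b n).+1) c s)%N.

(* The i-th part of the transpose of the partition formed by the digits. *)
Definition digits_ge (b n : nat) (c : nat -> nat) (i : nat) : nat :=
  #|[set s : 'I_(trunc_log b n).+1 | (i <= c s)%N]|.

(* Not logn, which counts only for prime b. For 1 < b and 0 < n, every k with
   b ^ k %| n satisfies k < n, so the bound on k excludes nothing. *)
Definition valb (b n : nat) : nat :=
  (\max_(k < n.+1 | b ^ k %| n) k)%N.

(* The sum over the integers k with 0 <= k <= log_b y; the natural ranges are
   y = x and y = n := ceil x. They differ exactly when b ^ m.-1 < x < b ^ m = n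
   for some m > 0, and then only y = n includes the term k = m, which is 1. For
   instance with b = 2, j = 1, x = 3 / 2 the sum is 2 for y = x and 3 for y = n,
   while digit_side is 3. *)
Definition ceil_sum (R : realType) (b j : nat) (x y : R) : int :=
  \sum_(k \in [set k : nat | k%:R <= logb b y]%classic)
    Num.ceil ((x + j%:R * b%:R ^+ k) / b%:R ^+ k.+1).

Definition digit_side (R : realType) (b j n : nat) (c : nat -> nat) : R :=
  (n%:R - (digit_sum b n c)%:R) / (b%:R - 1)
  + (trunc_log b n)%:R
  + (digits_ge b n c (b - j))%:R
  + (c (valb b n) != b - j)%N%:R.

Lemma base_expansion_exists (b n : nat) : (1 < b)%N -> (0 < n)%N ->
  base_expansion b n (fun s => (n %/ b ^ s) %% b)%N.
Proof.
move=> b1 n0; rewrite /base_expansion; have b0 := ltnW b1.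
have lo := trunc_logP b1 n0; have hi := trunc_log_ltn n b1.
set m := trunc_log b n in lo hi *.
have H M : n = (\sum_(s < M) ((n %/ b ^ s) %% b) * b ^ s + (n %/ b ^ M) * b ^ M)%N.
  elim: M => [|M IH]; first by rewrite big_ord0 expn0 divn1 muln1.
  rewrite big_ord_recr /= {1}IH -addnA; congr addn.
  by rewrite {1}(divn_eq (n %/ b ^ M) b) -divnMA -expnSr mulnDl expnS mulnA addnC.
split.
- by move=> s _; rewrite ltn_mod.
- rewrite modn_small; last by rewrite ltn_divLR ?expn_gt0 ?b0 // -expnS.
  by apply/eqP; rewrite -lt0n divn_gt0 // expn_gt0 b0.
- by rewrite {1}(H m.+1) (divn_small hi) mul0n addn0.
Qed.

(* Main.v *)
(* Write n = q b^(k+1) + c_k b^k + r with r < b^k. Since j > 0, the k-th term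
   is q + 1 + [(c_k + j) b^k + r > b^(k+1)], and the last bracket is
   [c_k >= b - j] - [c_k = b - j and r = 0]. As b - j > 0, the subtracted
   bracket can only be nonzero at k = nu_b(n); the quotients q sum to
   (n - s_b(n)) / (b - 1) as in Legendre's formula. All terms are positive, so
   shortening the range of k changes the sum. *)

Require Import Defs.
From mathcomp Require Import all_boot all_order all_algebra.
From mathcomp Require Import all_classical all_reals all_analysis.
From mathcomp Require Import zify ring lra.
Import Order.TTheory GRing.Theory Num.Theory.
Local Open Scope ring_scope.

(** Uniqueness of the expansion: the sum is [c 0] plus [b] times the sum for the shifted digits, so
    dividing by [b] drops the lowest digit. *)
Lemma base_expansion_digit (b n : nat) (c : nat -> nat) (k : nat) :
  (1 < b)%N -> base_expansion b n c -> (k <= trunc_log b n)%N ->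
  c k = (n %/ b ^ k %% b)%N.
Proof.
move=> b1 [cb _ en] kM; rewrite [in RHS]en.
have {}cb s : (s < (trunc_log b n).+1)%N -> (c s < b)%N by apply: cb.
have {}kM : (k < (trunc_log b n).+1)%N by [].
(* The number of digits is detached from [n], because the shifted digits represent another
   number. *)
move: (trunc_log b n).+1 cb kM => M {en}.
elim: M c k => // M IH c k cb kM.
rewrite big_ord_recl expn0 muln1.
have -> : (\sum_(i < M) c (lift ord0 i) * b ^ lift ord0 i =
          (\sum_(i < M) c i.+1 * b ^ i) * b)%N.
  by rewrite big_distrl /=; apply: eq_bigr => i _; rewrite expnSr mulnA.
case: k kM => [|k] kM.
  by rewrite expn0 divn1 addnC modnMDl modn_small // cb.
rewrite expnS divnMA [in RHS]addnC divnMDl ?(ltnW b1) //.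
rewrite (divn_small (cb 0%N isT)) // addn0.
by apply: (IH (fun s => c s.+1)) => // s sM; apply: cb.
Qed.

(** An index shift: the term [k = 0] is [n], and the term [k = M] vanishes. *)
Lemma sum_quotients (b n M : nat) : (n < b ^ M)%N ->
  (\sum_(k < M) n %/ b ^ k = \sum_(k < M) n %/ b ^ k.+1 + n)%N.
Proof.
move=> nM.
have : (\sum_(k < M.+1) n %/ b ^ k = \sum_(k < M) n %/ b ^ k + 0)%N.
  by rewrite big_ord_recr /= (divn_small nM).
rewrite addn0 => <-; rewrite big_ord_recl expn0 divn1 addnC.
by congr addn; apply: eq_bigr.
Qed.

(** Each quotient by [b ^ k] is [b] times the next quotient plus a digit; summing over [k] and
    comparing with the shifted sum gives Legendre's formula. *)
Lemma legendre_digits (b n M : nat) : (1 < b)%N -> (n < b ^ M)%N ->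
  ((\sum_(k < M) n %/ b ^ k.+1) * b.-1 + \sum_(k < M) (n %/ b ^ k %% b) = n)%N.
Proof.
move=> b1 nM; have := sum_quotients _ _ _ nM.
have -> : (\sum_(k < M) n %/ b ^ k =
    (\sum_(k < M) n %/ b ^ k.+1) * b + \sum_(k < M) (n %/ b ^ k %% b))%N.
  rewrite big_distrl -big_split /=; apply: eq_bigr => k _.
  by rewrite {1}(divn_eq (n %/ b ^ k) b) -divnMA -expnSr.
case: b b1 nM => // b _ _ /=; rewrite mulnS; lia.
Qed.

Lemma valb_dvdn (b n : nat) : (b ^ valb b n %| n)%N.
Proof.
rewrite /valb; apply: (big_ind (fun k => b ^ k %| n)%N) => //.
by move=> k l bk bl; case: (leqP k l).
Qed.

Lemma leq_valb (b n k : nat) : (1 < b)%N -> (0 < n)%N ->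
  (b ^ k %| n)%N -> (k <= valb b n)%N.
Proof.
move=> b1 n0 kn.
have kn1 : (k < n.+1)%N.
  by rewrite ltnS (leq_trans (ltnW (ltn_expl k b1))) // dvdn_leq.
by rewrite /valb; exact: (@leq_bigmax_cond _ _ _ (Ordinal kn1)).
Qed.

Lemma valb_leq_trunc_log (b n : nat) : (1 < b)%N -> (0 < n)%N ->
  (valb b n <= trunc_log b n)%N.
Proof.
by move=> b1 n0; apply: trunc_log_max => //; rewrite dvdn_leq // valb_dvdn.
Qed.

(** If [k < valb b n], then [b ^ k.+1] divides [n], so the digit at [k] is zero. *)
Lemma valb_eq (b n k : nat) : (1 < b)%N -> (0 < n)%N ->
  (b ^ k %| n)%N -> (n %/ b ^ k %% b != 0)%N -> k = valb b n.
Proof.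
move=> b1 n0 kn ck; apply/eqP; rewrite eqn_leq leq_valb // leqNgt.
apply: contra ck => kv.
rewrite -/(dvdn _ _) dvdn_divRL // -expnS.
exact: dvdn_trans (dvdn_exp2l b kv) (valb_dvdn b n).
Qed.

Lemma ceil_term (R : realType) (b j k n : nat) (x : R) : (1 < b)%N ->
  (0 < j < b)%N -> Num.ceil x = n%:Z ->
  Num.ceil ((x + j%:R * b%:R ^+ k) / b%:R ^+ k.+1) =
    (n %/ b ^ k.+1 + 1 + (b ^ k.+1 < n %% b ^ k.+1 + j * b ^ k))%N%:Z.
Proof.
move=> b1 /andP[j0 jb] hn.
have b0 : (0 < b)%N by apply: ltnW.
have B0 : (0 < b ^ k.+1)%N by rewrite expn_gt0 b0.
have BR0 : (0 : R) < b%:R ^+ k.+1 by rewrite exprn_gt0 // ltr0n.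
set t := (_ + _ + _)%N.
have /andP[xl xu] : n%:R - 1 < x <= n%:R.
  by have := Num.Theory.ceil_itv x; rewrite hn intrB.
have ed := divn_eq n (b ^ k.+1).
have rB := ltn_pmod n B0.
have jB : (0 < j * b ^ k < b ^ k.+1)%N.
  by rewrite muln_gt0 j0 expn_gt0 b0 /= expnS ltn_pmul2r // expn_gt0 b0.
(* Over the integers the strict lower bound gains a unit, which absorbs the gap between [x] and [n],
   as [n - 1 < x]. *)
have [tl tu] : ((t.-1 * b ^ k.+1).+1 <= n + j * b ^ k /\
                n + j * b ^ k <= t * b ^ k.+1)%N.
  rewrite /t; move: ed rB jB; move: (n %/ _)%N (n %% _)%N => q r.
  move: (b ^ k.+1)%N (j * b ^ k)%N => B J -> rB /andP[J0 JB].
  by case: (ltnP B (r + J)) => h; rewrite ?addn1 ?addn0 /= ?mulSn; split; lia.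
have tR : (t%:R : R) = t.-1%:R + 1 by rewrite natr1 prednK // /t; lia.
clearbody t; apply: ceil_def; rewrite intrB -!pmulrn.
move: tl tu; rewrite -!(ler_nat R) -natr1 !natrD !natrM !natrX => tl tu.
apply/andP; split.
- rewrite ltr_pdivlMr // tR; lra.
- rewrite ler_pdivrMr //; lra.
Qed.

(** With digit [d] and lower remainder [r < b ^ k], the sign of [d - (b - j)] decides the
    comparison, except when [d = b - j], where overflow means [r > 0]. The correction is added on
    the left to avoid truncated subtraction. *)
Lemma overflow_digit (b j k n : nat) : (1 < b)%N -> (0 < j < b)%N ->
  ((b ^ k.+1 < n %% b ^ k.+1 + j * b ^ k) +
     ((n %/ b ^ k %% b == b - j) && (b ^ k %| n)) =
   (b - j <= n %/ b ^ k %% b))%N.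
Proof.
move=> b1 /andP[j0 jb].
have b0 : (0 < b ^ k)%N by rewrite expn_gt0 (ltnW b1).
have -> : (n %% b ^ k.+1 = (n %/ b ^ k %% b) * b ^ k + n %% b ^ k)%N.
  have e := divn_eq (n %/ b ^ k) b.
  rewrite [X in (X %% b ^ k.+1)%N](divn_eq n (b ^ k)) {1}e.
  rewrite mulnDl -mulnA -expnS -addnA modnMDl modn_small //.
  have := ltn_pmod n b0; have := ltn_pmod (n %/ b ^ k) (ltnW b1).
  by rewrite expnS; move: (_ %% b)%N (n %% b ^ k)%N => d r; nia.
rewrite /dvdn expnS; have := ltn_pmod n b0.
move: (_ %% b)%N (n %% b ^ k)%N => d r; move: (b ^ k)%N b0 => B B0 rB.
have [db|db|db] := ltngtP d (b - j)%N.
- by rewrite /= addn0; case: ltnP => //; nia.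
- by rewrite /= addn0; case: ltnP => //; nia.
- have -> : (d * B + r + j * B = b * B + r)%N by rewrite db; nia.
  by rewrite -[X in (X < _)%N]addn0 ltn_add2l; case: r rB.
Qed.

(** As [i > 0], a nonzero summand has a nonzero digit at [k] with [b ^ k] dividing [n], which forces
    [k = valb b n]. *)
Lemma sum_lowest_digit (b i n : nat) : (1 < b)%N -> (0 < i)%N -> (0 < n)%N ->
  (\sum_(k < (trunc_log b n).+1) ((n %/ b ^ k %% b == i) && (b ^ k %| n)) =
   (n %/ b ^ valb b n %% b == i))%N.
Proof.
move=> b1 i0 n0.
have vm : (valb b n < (trunc_log b n).+1)%N by rewrite ltnS valb_leq_trunc_log.
rewrite (bigD1 (Ordinal vm)) //= valb_dvdn andbT big1 ?addn0 // => k /eqP kv.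
apply/eqP; rewrite eqb0; apply/negP => /andP[/eqP ck kn]; apply: kv.
by apply/val_inj/(@valb_eq b n); rewrite // ck -lt0n.
Qed.

Lemma ceil_term_digit (R : realType) (b j k n : nat) (x : R) : (1 < b)%N ->
  (0 < j < b)%N -> Num.ceil x = n%:Z ->
  Num.ceil ((x + j%:R * b%:R ^+ k) / b%:R ^+ k.+1) =
    (n %/ b ^ k.+1 + 1 + (b - j <= n %/ b ^ k %% b))%N%:Z
    - ((n %/ b ^ k %% b == b - j) && (b ^ k %| n))%N%:Z.
Proof.
move=> b1 hj hn.
rewrite (ceil_term _ _ _ _ _ _ b1 hj hn) -(overflow_digit b j k n b1 hj); lia.
Qed.

(** The sum over the full range [0 <= k <= m], with which both sums of the theorem are compared. *)
Lemma sum_ceil_terms (R : realType) (b j n : nat) (x : R) (c : nat -> nat) :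
  (1 < b)%N -> (0 < j < b)%N -> (0 < n)%N -> Num.ceil x = n%:Z ->
  base_expansion b n c ->
  (\sum_(k < (trunc_log b n).+1)
     Num.ceil ((x + j%:R * b%:R ^+ k) / b%:R ^+ k.+1))%:~R =
  digit_side R b j n c.
Proof.
move=> b1 hj n0 hn hc.
have cE (k : 'I_(trunc_log b n).+1) : c k = (n %/ b ^ k %% b)%N.
  by apply: base_expansion_digit => //; rewrite -ltnS.
under eq_bigr do rewrite (ceil_term_digit _ _ _ _ _ _ b1 hj hn).
rewrite sumrB -!(big_morph Posz PoszD (erefl 0%:Z)); set M := (trunc_log b n).+1.
have i0 : (0 < b - j)%N by rewrite subn_gt0; case/andP: hj.
rewrite sum_lowest_digit // !big_split /=.
rewrite /digit_side /digit_sum /digits_ge -/M.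
have -> : (\sum_(i < M) (b - j <= n %/ b ^ i %% b) =
           #|[set s : 'I_M | (b - j <= c s)%N]|)%N.
  rewrite -sum1dep_card [RHS]big_mkcond.
  by apply: eq_bigr => k _; rewrite cE; case: leqP.
under [in RHS]eq_bigr do rewrite cE.
rewrite (@base_expansion_digit _ _ _ (valb b n) b1 hc) ?valb_leq_trunc_log //.
have := @legendre_digits _ _ M b1 (trunc_log_ltn n b1).
set S := (\sum_(k < M) n %/ _)%N; set s := (\sum_(k < M) _)%N.
move=> /(congr1 (fun i => i%:R : R)).
rewrite natrD natrM -subn1 natrB ?(ltnW b1) // => <-.
rewrite addrK mulfK; last by rewrite subr_eq0 pnatr_eq1 neq_ltn b1 orbT.
(* The constant terms contribute [m + 1]; the extra 1 minus the bracket for equality is the bracket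
   for inequality. *)
rewrite sum_nat_const card_ord muln1 /M intrB -!pmulrn !natrD -natr1.
by case: eqP => _ /=; ring.
Qed.

Lemma logb_range (R : realType) (b M : nat) (y : R) : (1 < b)%N ->
  b%:R ^+ M <= y -> y < b%:R ^+ M.+1 ->
  [set k : nat | k%:R <= logb b y]%classic = `I_M.+1.
Proof.
move=> b1 lo hi.
have b0 : (0 : R) < b%:R by rewrite ltr0n ltnW.
have y0 : 0 < y by apply: lt_le_trans lo; rewrite exprn_gt0.
have l0 : 0 < ln (b%:R : R) by rewrite ln_gt0 // ltr1n.
apply/seteqP; split => k /=; rewrite /logb ler_pdivlMr // mulr_natl -lnXn //
  ler_ln ?posrE ?exprn_gt0 // => h.
- by have := le_lt_trans h hi; rewrite ltr_eXn2l // ltr1n.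
- by apply: le_trans lo; rewrite ler_weXn2l // ler1n ltnW.
Qed.

Lemma ceil_sum_range (R : realType) (b j M : nat) (x y : R) : (1 < b)%N ->
  b%:R ^+ M <= y -> y < b%:R ^+ M.+1 ->
  ceil_sum b j x y =
  \sum_(k < M.+1) Num.ceil ((x + j%:R * b%:R ^+ k) / b%:R ^+ k.+1).
Proof.
by move=> b1 lo hi; rewrite /ceil_sum (logb_range _ _ _ _ b1 lo hi) -fsbig_ord.
Qed.

Theorem theorem5 (R : realType) (b j : nat) (x : R) (n : nat) (c : nat -> nat)
    (hb : (2 <= b)%N) (hj : (0 < j < b)%N) (hx : 1 <= x)
    (hn : Num.ceil x = n%:Z) (hc : base_expansion b n c) :
  (b%:R ^+ trunc_log b n <= x <->
     (ceil_sum b j x x)%:~R = digit_side R b j n c) /\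
  (ceil_sum b j x n%:R)%:~R = digit_side R b j n c.
Proof.
have /andP[xl xu] : n%:R - 1 < x <= n%:R.
  by have := Num.Theory.ceil_itv x; rewrite hn intrB.
have n0 : (0 < n)%N by rewrite -(ltr0n R); lra.
have b0 : (0 < b)%N by apply: ltnW.
have lo := trunc_logP hb n0; have hi := trunc_log_ltn n hb.
have sumE := sum_ceil_terms _ _ _ _ _ _ hb hj n0 hn hc.
have hiR : (n%:R : R) < b%:R ^+ (trunc_log b n).+1 by rewrite -natrX ltr_nat.
split; last first.
  by rewrite (@ceil_sum_range _ _ _ (trunc_log b n)) // -natrX ler_nat.
split => [xlo|]; first
  by rewrite (@ceil_sum_range _ _ _ (trunc_log b n)) ?(le_lt_trans xu).
(* Otherwise [b ^ m.-1 <= x < b ^ m = n], and the term [k = m] is missing. *)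
case: leP => // xm; case em : (trunc_log b n) xm lo sumE => [|m] xm lo sumE.
  by move: xm; rewrite expr0 ltNge hx.
have xlo : b%:R ^+ m <= x.
  (* Here [m.+1] is the leading position, so [b ^ m <= n - 1 < x]. *)
  have : (b ^ m < n)%N by apply: leq_trans lo; rewrite ltn_exp2l.
  rewrite -(ler_nat R) -natr1 natrX; lra.
rewrite (ceil_sum_range _ _ _ m) // -sumE => /eqP.
(* Equality would make the missing term [k = m.+1] zero, but by [ceil_term] it is at least 1. *)
rewrite [X in _ == X%:~R]big_ord_recr intrD -[eqbLHS]addr0
  (inj_eq (addrI _)) eq_sym intr_eq0 (ceil_term _ _ _ _ _ _ hb hj hn); lia.
Qed.
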